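(* Let $\sum_{n=1}^\infty a_n$ and $\sum_{n=1}^\infty b_n$ be series of strictly positive real numbers. Assume that $\lim_{n\rightarrow\infty}a_n=0$, that $\lim_{n\rightarrow\infty}\frac{a_n}{b_n}=0$, and that $\sum_{n=1}^\infty b_n$ diverges. Then $\mathbb{N}_{a_n}$ and $\mathbb{N}_{b_n}$ are not homeomorphic.
   Context: $\mathbb{N}=\{1,2,3,\dots\}$. For a series $\sum_{n=1}^\infty a_n$ of strictly positive real numbers and $A\subseteq\mathbb{N}$, write $\sum_A a_n=\sum_{n\in A}a_n\in[0,\infty]$. $\mathbb{N}_{a_n}$ denotes the set $\mathbb{N}$ with the topology whose closed sets are exactly $\mathbb{N}$ itself and all $A\subseteq\mathbb{N}$ with $\sum_A a_n<\infty$. *)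

(* Defs.v *)
From HB Require Import structures.
From mathcomp Require Import all_boot all_order all_algebra.
From mathcomp Require Import all_classical all_reals all_analysis.

Set Implicit Arguments.
Unset Strict Implicit.
Unset Printing Implicit Defensive.

Import Order.TTheory GRing.Theory Num.Theory.
Import numFieldNormedType.Exports.

Local Open Scope classical_set_scope.
Local Open Scope ring_scope.

(* Sequences are indexed from 0: the value of a sequence at n : nat is its
   (n+1)-st term, and n : nat stands for the positive integer n+1. *)

Section SeriesSpace.
Variables (R : realType) (a : nat -> R).

Definition sum_on (A : set nat) : \bar R := \esum_(n in A) (a n)%:E.

Definition series_closed (A : set nat) : Prop :=
  A = setT \/ (sum_on A < +oo)%E.

Definition series_open (U : set nat) : Prop := series_closed (~` U).

(* Positivity is what makes the sets in series_closed stable under finite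
   unions and arbitrary intersections, so the space carries its proof. *)
Hypothesis a_gt0 : forall n, 0 < a n.

Lemma le_sum_on (A B : set nat) : A `<=` B -> (sum_on A <= sum_on B)%E.
Proof.
move=> AB; rewrite /sum_on esum_mkcond [leRHS]esum_mkcond.
apply: le_esum => n _; case: ifPn => [/set_mem/AB/mem_set -> //|_].
by case: ifP => // _; rewrite lee_fin ltW.
Qed.

Lemma sum_onU (A B : set nat) :
  (sum_on (A `|` B) <= sum_on A + sum_on B)%E.
Proof.
have a0 n : (0 <= (a n)%:E)%E by rewrite lee_fin ltW.
rewrite /sum_on !(esum_mkcond _ (fun n => (a n)%:E)) -esumD.
- apply: le_esum => n _; rewrite in_setU.
  by case: (n \in A); case: (n \in B) => /=; rewrite ?adde0 ?add0e ?leeDl.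
- by move=> n _; case: ifP.
- by move=> n _; case: ifP.
Qed.

Lemma series_openT : series_open setT.
Proof. by right; rewrite setCT /sum_on esum_set0 ltry. Qed.

Lemma series_openI : setI_closed series_open.
Proof.
move=> U V [UT|Ufin] [VT|Vfin]; rewrite /series_open setCI.
- by left; rewrite UT setTU.
- by left; rewrite UT setTU.
- by left; rewrite VT setUT.
- by right; apply: le_lt_trans (sum_onU _ _) _; rewrite lte_add_pinfty.
Qed.

Lemma series_open_bigU (I : Type) (f : I -> set nat) :
  (forall i, series_open (f i)) -> series_open (\bigcup_i f i).
Proof.
move=> fo; have [[i ifin]|nfin] := pselect (exists i, (sum_on (~` f i) < +oo)%E).
  right; apply: le_lt_trans ifin; apply: le_sum_on.
  by apply: subsetC => n fin; exists i.
left; rewrite setC_bigcup; apply/seteqP; split => // n _ i _.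
by case: (fo i) => [-> //|ifin]; case: nfin; exists i.
Qed.

Definition series_space of (forall n, 0 < a n) : Type := nat.

HB.instance Definition _ := Choice.copy (series_space a_gt0) nat.
HB.instance Definition _ := isOpenTopological.Build (series_space a_gt0)
  series_openT series_openI series_open_bigU.

Lemma closed_series_space (A : set (series_space a_gt0)) :
  closed A <-> A = setT \/ (\esum_(n in (A : set nat)) (a n)%:E < +oo)%E.
Proof.
by rewrite -openC; change (series_open (~` A) <-> series_closed A);
  rewrite /series_open setCK.
Qed.

End SeriesSpace.

Definition homeomorphic (X Y : topologicalType) : Prop :=
  exists (f : X -> Y) (g : Y -> X),
    [/\ cancel f g, cancel g f, continuous f & continuous g].

(* Main.v *)
(** A homeomorphism N_a -> N_b is a bijection f such that c := b o f is summable
    on every set where a is (closed proper sets go to closed proper sets).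
    If c > 2^j a on a set of infinite a-sum for every j, then, as a -> 0, blocks
    of a-mass about 2^-j can be picked there; their union has finite a-sum but
    infinite c-sum. So c <= k a off a set of finite c-sum. On the other hand
    2 k a_n <= b_n for large n, while b is a rearrangement of c, hence up to
    summable errors sum (2 k a - y)^+ <= sum (b - y)^+ <= sum (k a - y)^+ for
    every y > 0. Letting y -> 0, this forces sum a < oo, whence sum b < oo. *)
Require Import Defs.
From mathcomp Require Import all_boot all_order all_algebra.
From mathcomp Require Import all_classical all_reals all_analysis.
From mathcomp Require Import lra.
Import Order.TTheory GRing.Theory Num.Theory.
Import numFieldNormedType.Exports.
Local Open Scope classical_set_scope.
Local Open Scope ring_scope.

(** * Sums over sets of indices: partial sums, initial segments, tails *)

Lemma ge_sum_on (R : realType) (u : nat -> R) (A : set nat) (M : R) :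
  (forall n, 0 <= u n) ->
  (forall n, \sum_(0 <= i < n | i \in A) u i <= M) -> (sum_on u A <= M%:E)%E.
Proof.
move=> u0 uM; rewrite /sum_on -[A]set_mem_set -nneseries_esum; last first.
  by move=> n _; rewrite lee_fin.
apply: lime_le; first by apply: is_cvg_nneseries => n _ _; rewrite lee_fin.
by apply: nearW => n; rewrite sumEFin lee_fin.
Qed.

Lemma partial_le_sum_on (R : realType) (u : nat -> R) (A : set nat) n :
  (forall n, 0 <= u n) ->
  ((\sum_(0 <= i < n | i \in A) u i)%:E <= sum_on u A)%E.
Proof.
move=> u0; rewrite /sum_on -[X in esum X]set_mem_set -nneseries_esum; last first.
  by move=> k _; rewrite lee_fin.
by rewrite -sumEFin; apply: nneseries_lim_ge => k _ _; rewrite lee_fin.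
Qed.

Lemma sum_on_ge0 (R : realType) (u : nat -> R) (A : set nat) :
  (forall n, 0 <= u n) -> (0 <= sum_on u A)%E.
Proof. by move=> u0; apply: esum_ge0 => n _; rewrite lee_fin. Qed.

Lemma sum_on_fin_num (R : realType) (u : nat -> R) (A : set nat) :
  (forall n, 0 <= u n) -> (sum_on u A < +oo)%E -> sum_on u A \is a fin_num.
Proof. by move=> u0 ?; rewrite ge0_fin_numE // sum_on_ge0. Qed.

Lemma sum_onZ (R : realType) (u : nat -> R) (A : set nat) (k : R) :
  0 <= k -> (forall n, 0 <= u n) ->
  (sum_on (fun n => k * u n)%R A = k%:E * sum_on u A)%E.
Proof.
move=> k0 u0; rewrite /sum_on -[A]set_mem_set -!nneseries_esum.
- by rewrite -nneseriesZl // => n _; rewrite lee_fin.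
- by move=> n _; rewrite lee_fin.
- by move=> n _; rewrite lee_fin mulr_ge0.
Qed.

Lemma sum_on_initial (R : realType) (u : nat -> R) (A : set nat) N :
  (forall n, 0 <= u n) ->
  sum_on u (A `&` `I_N) = (\sum_(0 <= i < N | i \in A) u i)%:E.
Proof.
move=> u0.
have -> : \sum_(0 <= i < N | i \in A) u i =
          \sum_(0 <= i < N | i \in A `&` `I_N) u i.
  rewrite big_nat_cond [RHS]big_nat_cond; apply: eq_bigl => i /=.
  by apply: andb_id2l => iN; rewrite in_setI [X in _ && X]mem_set ?andbT.
apply/eqP; rewrite eq_le partial_le_sum_on // andbT; apply: ge_sum_on => // n.
(* Going up to [N + n] covers both the cut [n] and the bound [N], past which the set is empty. *)
apply: (@le_trans _ _ (\sum_(0 <= i < N + n | i \in A `&` `I_N) u i)).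
  by rewrite [leRHS](@big_cat_nat _ _ _ n) ?leq_addl //= lerDl sumr_ge0.
rewrite (@big_cat_nat _ _ _ N 0%N (N + n)%N) ?leq_addr //= [X in _ + X]big_nat_cond.
rewrite [X in _ + X]big_pred0 ?addr0 // => i.
by apply/negP => /andP[/andP[Ni _] /set_mem [_ /=]]; rewrite ltnNge Ni.
Qed.

Lemma sum_on_tail (R : realType) (u : nat -> R) (A : set nat) N :
  (forall n, 0 <= u n) ->
  sum_on u A = ((\sum_(0 <= i < N | i \in A) u i)%:E
                + sum_on u [set n | A n /\ (N <= n)%N])%E.
Proof.
move=> u0; rewrite {1}/sum_on (esumID `I_N); last by move=> ? _; rewrite lee_fin.
rewrite -!/(sum_on u _) sum_on_initial //; congr (_ + sum_on u _)%E.
apply/seteqP; split => n /= [An nN]; split => //.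
  by rewrite leqNgt; apply/negP.
by apply/negP; rewrite -leqNgt.
Qed.

Lemma sum_on_eventually0 (R : realType) (u : nat -> R) (A : set nat) N :
  (forall n, 0 <= u n) -> (forall n, (N <= n)%N -> u n = 0) ->
  (sum_on u A < +oo)%E.
Proof.
move=> u0 uN; rewrite (sum_on_tail _ u A N) // [X in (_ + X)%E]esum1.
  by rewrite adde0 ltry.
by move=> n [_ /uN ->].
Qed.

(** * Blocks of prescribed mass, and domination off a summable set *)

(* Greedy choice: past the point where all terms are below [e], stop as soon as
   the partial sum reaches [e]. *)
Lemma divergent_block (R : realType) (u : nat -> R) (E : set nat) (e : R) k :
  (forall n, 0 <= u n) -> u n @[n --> \oo] --> 0 -> ~ (sum_on u E < +oo)%E ->
  0 < e ->
  exists A : set nat, [/\ A `<=` E, forall n, A n -> (k <= n)%N,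
    (e%:E <= sum_on u A)%E & (sum_on u A <= (e + e)%:E)%E].
Proof.
move=> u0 u_to0 Edvg e0.
have [m0 _ um0] : \forall n \near \oo, u n < e by exact: (cvgr_lt 0).
pose m := maxn k m0; pose B := [set n | E n /\ (m <= n)%N].
have Bdvg : ~ (sum_on u B < +oo)%E.
  apply: contra_not Edvg => Bfin.
  by rewrite (sum_on_tail _ u E m) // lte_add_pinfty ?ltry.
pose P n := \sum_(0 <= i < n | i \in B) u i.
have exP : exists n, e <= P n.
  apply: contrapT => noP; apply: Bdvg; apply: (le_lt_trans _ (ltry e)).
  apply: ge_sum_on => // n; rewrite leNgt; apply/negP => /ltW eP.
  by apply: noP; exists n.
case: (ex_minnP exP) => -[|N] eN minN.
  by move: eN; rewrite /P big_nil leNgt e0.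
have PN : P N < e by rewrite ltNge; apply/negP => /minN; rewrite ltnn.
have AE : sum_on u (B `&` `I_N.+1) = (P N.+1)%:E by exact: sum_on_initial.
exists (B `&` `I_N.+1); split.
- by move=> n [[]].
- by move=> n [[_ mn] _]; apply: leq_trans mn; exact: leq_maxl.
- by rewrite AE lee_fin.
- rewrite AE lee_fin /P big_mkcond big_nat_recr //= -big_mkcond -/(P N).
  apply: lerD; first exact: ltW.
  case: ifPn => [/set_mem [_ mN]|_]; last exact: ltW.
  by apply/ltW/um0 => /=; apply: leq_trans mN; exact: leq_maxr.
Qed.

(** Only the [A j] with [j < n] meet the indices below [n], so each partial sum is at most a finite
    double sum, bounded by a geometric one. *)
Lemma sum_on_bigcup_le (R : realType) (u : nat -> R) (A : nat -> set nat) (e : R) :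
  (forall n, 0 <= u n) -> (forall j n, A j n -> (j <= n)%N) -> 0 <= e ->
  (forall j, (sum_on u (A j) <= (e * 2^-1 ^+ j)%:E)%E) ->
  (sum_on u (\bigcup_j A j) <= (2 * e)%:E)%E.
Proof.
move=> u0 Age e0 Ale; apply: ge_sum_on => // n.
have geo k : \sum_(0 <= j < k) e * 2^-1 ^+ j = 2 * e - 2 * e * 2^-1 ^+ k.
  elim: k => [|k IH]; first by rewrite big_nil expr0; lra.
  by rewrite big_nat_recr //= IH exprS; lra.
apply: (@le_trans _ _ (\sum_(0 <= j < n) e * 2^-1 ^+ j)); last first.
  by rewrite geo gerBl !mulr_ge0 // exprn_ge0 // invr_ge0.
apply: (@le_trans _ _ (\sum_(0 <= j < n) \sum_(0 <= i < n | i \in A j) u i)).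
  under [leRHS]eq_bigr do rewrite big_mkcond.
  rewrite exchange_big /= big_mkcond big_nat_cond [leRHS]big_nat_cond.
  apply: ler_sum => i; rewrite andbT => /andP[_ iltn].
  have t0 j : 0 <= (if i \in A j then u i else 0) by case: ifP.
  case: ifPn => [/set_mem [j _ Aji]|_]; last exact: sumr_ge0.
  rewrite (bigD1_seq j) ?iota_uniq //=; last first.
    by rewrite mem_index_iota (leq_ltn_trans (Age _ _ Aji) iltn).
  by rewrite mem_set // lerDl sumr_ge0.
apply: ler_sum => j _; rewrite -lee_fin; apply: le_trans (Ale j).
exact: partial_le_sum_on.
Qed.

(** Every tail takes at least 1, so every partial sum is at most the total minus 1; a finite total
    would then be at most itself minus 1. *)
Lemma sum_on_ge1_lty (R : realType) (u : nat -> R) (U : set nat) :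
  (forall n, 0 <= u n) ->
  (forall j, (1 <= sum_on u [set n | U n /\ (j <= n)%N])%E) ->
  ~ (sum_on u U < +oo)%E.
Proof.
move=> u0 tail1 Ufin; have Ufn := sum_on_fin_num _ _ _ u0 Ufin.
suff : (sum_on u U <= (fine (sum_on u U) - 1)%:E)%E.
  by rewrite -{1}(fineK Ufn) lee_fin; lra.
apply: ge_sum_on => // n.
rewrite lerBrDr -lee_fin EFinD fineK // (sum_on_tail _ u U n) //.
exact: leeD2l.
Qed.

Lemma dominated_off_summable (R : realType) (u v : nat -> R) :
  (forall n, 0 <= u n) -> (forall n, 0 <= v n) -> u n @[n --> \oo] --> 0 ->
  (forall A, sum_on u A < +oo -> sum_on v A < +oo)%E ->
  exists2 k : R, 0 < k & (sum_on v [set n | (k * u n < v n)%R] < +oo)%E.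
Proof.
move=> u0 v0 u_to0 uv; apply: contrapT => nok.
pose E j := [set n | 2 ^+ j * u n < v n].
have Edvg j : ~ (sum_on u (E j) < +oo)%E.
  by move=> /uv Efin; apply: nok; exists (2 ^+ j) => //; rewrite exprn_gt0.
have e0 j : 0 < (2^-1 : R) ^+ j by rewrite exprn_gt0 // invr_gt0.
have [A AP] :=
  choice (fun j => divergent_block _ u _ _ j u0 u_to0 (Edvg j) (e0 j)).
have Ufin : (sum_on u (\bigcup_j A j) < +oo)%E.
  (* Each block has [u]-sum at most [2 * 2^-1 ^+ j]; summing the geometric series doubles the
     constant. *)
  apply: (@le_lt_trans _ _ (2 * 2)%:E); last exact: ltry.
  apply: sum_on_bigcup_le => // [j n|j]; first by have [_ + _ _] := AP j; apply.
  by have [_ _ _] := AP j; rewrite [in X in _ -> X]mulrC mulr_natr mulr2n.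
have := uv _ Ufin; apply: sum_on_ge1_lty => // j.
have [AE Aj eA _] := AP j.
apply: (@le_trans _ _ (sum_on v (A j))); last first.
  rewrite /sum_on esum_mkcond [leRHS]esum_mkcond; apply: le_esum => n _.
  case: ifPn => [/set_mem An|_]; last by case: ifP; rewrite lee_fin.
  by rewrite mem_set //; split; [exists j | exact: Aj].
(* On [A j], inside [E j], [v] exceeds [2 ^+ j * u], while [u] sums to at least [2^-1 ^+ j]: the
   block contributes at least 1. *)
apply: (@le_trans _ _ ((2 ^+ j)%:E * sum_on u (A j))%E).
  rewrite (_ : 1%E = (2 ^+ j)%:E * (2^-1 ^+ j)%:E)%E; last first.
    by rewrite -EFinM -exprMn divff // expr1n.
  by apply: lee_wpmul2l eA; rewrite lee_fin exprn_ge0.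
by rewrite -sum_onZ //; apply: le_esum => n /AE /= /ltW; rewrite lee_fin.
Qed.

(** * Comparison with a rearrangement by truncation *)

(* The truncations (x - y)^+ make every sum below finite and invariant under
   the rearrangement f, so that sum (u - y)^+ can be cancelled after using
   (2 u - y)^+ >= (u - y)^+ + u 1_{u >= y}; what remains bounds
   sum u 1_{u >= y} uniformly in y > 0. *)
Lemma rearrangement_summable (R : realType) (u b : nat -> R) (f : nat -> nat)
    (E : set nat) :
  (forall n, 0 < u n) -> (forall n, 0 <= b n) -> u n @[n --> \oo] --> 0 ->
  (\forall n \near \oo, 2 * u n <= b n) ->
  set_bij setT setT f ->
  (forall n, ~ E n -> b (f n) <= u n) -> (sum_on (b \o f) E < +oo)%E ->
  (sum_on u setT < +oo)%E.
Proof.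
move=> u0 b0 u_to0 [N _ ub] fbij bfu Efin.
have ge0u n : 0 <= u n by exact: ltW.
(* [w] compensates for the finitely many indices where [2 * u n <= b n] may fail:
   [2 * u n <= w n + b n] holds everywhere. *)
pose w n := if (n < N)%N then 2 * u n else 0.
have w0 n : 0 <= w n by rewrite /w; case: ifP => // _; rewrite mulr_ge0.
have wfin : (sum_on w setT < +oo)%E.
  by apply: (@sum_on_eventually0 _ _ _ N) => // n; rewrite leqNgt /w => /negbTE ->.
pose K := (sum_on w setT + sum_on (b \o f) E)%E.
have Kfin : K \is a fin_num.
  by rewrite fin_numD !sum_on_fin_num // => n; rewrite /= b0.
pose D (v : nat -> R) (y : R) n : R := Num.max (v n - y) 0.
have D0 v y n : 0 <= D v y n by rewrite le_max lexx orbT.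
have cutK (y : R) : 0 < y ->
    (sum_on (fun n => if (y <= u n)%R then u n else 0%R) setT <= K)%E.
  move=> y0.
  have Dfin : sum_on (D u y) setT \is a fin_num.
    have [M _ uM] : \forall n \near \oo, u n < y by exact: (cvgr_lt 0).
    apply: sum_on_fin_num => //; apply: (@sum_on_eventually0 _ _ _ M) => // n Mn.
    by apply/max_idPr; rewrite subr_le0 ltW // uM.
  rewrite -(leeD2rE _ _ Dfin).
  apply: (@le_trans _ _ (sum_on w setT + sum_on (D b y) setT)%E).
    rewrite /sum_on -!esumD; try by move=> n _; rewrite lee_fin //; case: ifP.
    apply: le_esum => n _; rewrite -!EFinD lee_fin /D.
    have wb : 2 * u n <= w n + b n.
      rewrite /w; case: (ltnP n N) => [_|/ub /=]; last by rewrite add0r.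
      by rewrite lerDl.
    move: (u n) (b n) (w n) (u0 n) (b0 n) (w0 n) wb => U B W U0 B0 W0 wb.
    by case: (leP (U - y) 0) => ?; case: (leP (B - y) 0) => ?;
       case: (leP y U) => ?; lra.
  rewrite /K -addeA; apply: leeD2l.
  (* After reindexing by [f], the truncation of [b] is at most [b (f n)] on [E], which [K] accounts
     for, and at most that of [u] off [E]. *)
  rewrite {1}/sum_on (reindex_esum setT _ f) //= /sum_on.
  rewrite [X in (_ <= X + _)%E]esum_mkcond.
  rewrite -esumD; last 2 first.
    by move=> n _; case: ifP => // _; rewrite lee_fin /= b0.
    by move=> n _; rewrite lee_fin.
  apply: le_esum => n _; case: ifPn => [_|/negP nE].
    rewrite -EFinD lee_fin /D /=.
    move: (b (f n)) (u n) (b0 (f n)) (ge0u n) => B U B0 U0.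
    by case: (leP (B - y) 0) => ?; case: (leP (U - y) 0) => ?; lra.
  have /bfu : ~ E n by move=> En; apply: nE; exact/mem_set.
  rewrite add0e lee_fin /D.
  by case: (leP (b (f n) - y) 0) => ?; case: (leP (u n - y) 0) => ?; lra.
apply: le_lt_trans (ltry (fine K)); apply: ge_sum_on => // n.
(* With [y] below the first [n] terms, the cut-off sum contains their whole partial sum, and [K]
   does not depend on [y]. *)
have [y y0 yu] : exists2 y, 0 < y & forall i, (i < n)%N -> y <= u i.
  elim: n => [|n [y y0 yu]]; first by exists 1.
  exists (Num.min y (u n)) => [|i]; first by rewrite lt_min y0 u0.
  by rewrite ltnS leq_eqVlt ge_min => /predU1P[->|/yu ->//]; rewrite lexx orbT.
rewrite -lee_fin fineK //; apply: le_trans (cutK y y0).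
have c0 i : 0 <= (if y <= u i then u i else 0) by case: ifP.
apply: le_trans (partial_le_sum_on _ _ setT n c0); rewrite lee_fin.
rewrite big_nat_cond [leRHS]big_nat_cond; apply: ler_sum => i.
by move=> /andP[/andP[_ /yu ->]].
Qed.

(** * Homeomorphisms and summability *)

(** The preimage of a set under [g] is its image under [f], so its [b]-sum is the sum of [b \o f]
    over the set; continuity of [g] makes this preimage closed. *)
Lemma continuous_sum_on (R : realType) (a b : nat -> R)
    (a_gt0 : forall n, 0 < a n) (b_gt0 : forall n, 0 < b n)
    (f : nat -> nat) (g : series_space b_gt0 -> series_space a_gt0) A :
  cancel f g -> cancel g f -> continuous g ->
  (sum_on a A < +oo)%E -> (sum_on (b \o f) A < +oo)%E.
Proof.
move=> fK gK /continuous_closedP gc Afin.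
have b0 n : 0 <= b n by exact: ltW.
(* The point 0 is removed so that the set is proper: the closedness of setT says
   nothing about sums. *)
have A0fin : (sum_on a (A `\ 0%N) < +oo)%E.
  by apply: le_lt_trans Afin; apply: le_sum_on => //; exact: subDsetl.
have : (sum_on (b \o f) (A `\ 0%N) < +oo)%E.
  have /gc/closed_series_space : closed (A `\ 0%N : set (series_space a_gt0)).
    by apply/closed_series_space; right.
  case=> [gT|].
    have : (g @^-1` (A `\ 0%N)) (f 0%N) by rewrite gT.
    by rewrite /= fK => -[_ /=].
  rewrite (reindex_esum (A `\ 0%N) _ f) //; split => [n /=|n m _ _ /=|m /= Am].
  - by rewrite fK.
  - exact: (can_inj fK).
  - by exists (g m) => //; rewrite gK.
move=> fin0.
apply: (@le_lt_trans _ _ (sum_on (b \o f) ([set 0%N] `|` (A `\ 0%N)))).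
  apply: le_sum_on => [n|n An]; first exact: b_gt0.
  by have [->|/eqP n0] := eqVneq n 0%N; [left|right].
have bf0 n : 0 < (b \o f) n by exact: b_gt0.
apply: le_lt_trans (sum_onU bf0 _ _) _.
apply: lte_add_pinfty => //.
by rewrite /sum_on esum_set1 ?ltry ?lee_fin ?b0.
Qed.

Theorem theorem1p4 (R : realType) (a b : nat -> R)
    (a_gt0 : forall n : nat, 0 < a n) (b_gt0 : forall n : nat, 0 < b n) :
  a n @[n --> \oo] --> 0 ->
  a n / b n @[n --> \oo] --> 0 ->
  ~ cvgn (series b) ->
  ~ homeomorphic (series_space a_gt0) (series_space b_gt0).
Proof.
move=> a_to0 ab_to0 b_dvg [f [g [fK gK _ gc]]].
have a0 n : 0 <= a n by exact: ltW.
have b0 n : 0 <= b n by exact: ltW.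
have fbij : set_bij [set: nat] [set: nat] f.
  split => // [n m _ _|m _]; first exact: (can_inj fK).
  by exists (g m) => //; rewrite gK.
have transfer A : (sum_on a A < +oo -> sum_on (b \o f) A < +oo)%E.
  exact: (continuous_sum_on _ _ _ a_gt0 b_gt0 f g).
have [k k0 Ek] :=
  dominated_off_summable _ a (b \o f) a0 (fun n => b0 (f n)) a_to0 transfer.
have ka_fin : (sum_on (fun n => (k * a n)%R) setT < +oo)%E.
  apply: (rearrangement_summable _ _ b f _ _ b0 _ _ fbij _ Ek).
  - by move=> n; rewrite mulr_gt0.
  - by rewrite -(mulr0 k); apply: cvgMl_tmp.
  (* The constant is chosen so that [a n / b n] below it means [2 * (k * a n) < b n]. *)
  - have e0 : 0 < (2 * k)^-1 by rewrite invr_gt0 mulr_gt0.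
    near=> n; have : a n / b n < (2 * k)^-1 by near: n; exact: (cvgr_lt 0).
    rewrite ltr_pdivrMr // => /ltW; rewrite mulrC ler_pdivlMr ?mulr_gt0 //.
    by rewrite mulrC mulrA.
  - by move=> n /= /negP; rewrite -leNgt.
have a_fin : (sum_on a [set: nat] < +oo)%E.
  have -> : sum_on a setT = sum_on (fun n => k^-1 * (k * a n)) setT.
    by apply: eq_esum => n _; rewrite mulKf // gt_eqF.
  rewrite sum_onZ ?invr_ge0 ?ltW // => [|n]; last by rewrite mulr_ge0 // ltW.
  by rewrite lte_mul_pinfty // lee_fin invr_ge0 ltW.
(* As [a] is summable over all indices, so is [b \o f], and its sum is that of its rearrangement
   [b]. *)
apply: b_dvg; apply: nnseries_is_cvg => //.
rewrite nneseries_esumT; last by move=> n; rewrite lee_fin.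
by rewrite (reindex_esum _ _ _ _ fbij); exact: transfer.
Unshelve. all: by end_near. Qed.
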